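(* Let $Q$ be a set (a multiset with distinct elements) of cardinality $n\ge 2$ over $\mathcal{N}$, so that $\mathcal{B}_Q$ is a generic weight subspace, and let $\varrho\colon\mathcal{A}(S_n)\to\mathrm{End}(\mathcal{B}_Q)$ be the twisted regular representation. Let $\mathbf{A}_Q:=\varrho(\alpha^*_n)$ with $\alpha^*_n=\sum_{g\in S_n}g^*$, and for $1\le k\le n-1$ let $\mathbf{B}_{Q,n-k+1}:=\varrho(\beta^*_{n-k+1})$ with $\beta^*_{n-k+1}=\sum_{k\le m\le n}t_{m,k}^*$. Then: (i) $$\det\mathbf{A}_Q=\prod_{2\le m\le n}\ \prod_{T\in\binom{Q}{m}}(1-\sigma_T)^{(m-2)!\cdot(n-m+1)!};$$ (ii) for $1\le k\le n-1$, $$\det\mathbf{B}_{Q,n-k+1}=\prod_{2\le m\le n-k+1}\ \prod_{T\in\binom{Q}{m}}(1-\sigma_T)^{(m-2)!\cdot(n-m)!}.$$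
   Context: Free algebra and weight subspaces: $\mathcal{N}$ is a fixed finite set of nonnegative integers, and $q_{ij}$ ($i,j\in\mathcal{N}$) are given complex numbers. $\mathcal{B}$ is the free unital associative $\mathbb{C}$-algebra on generators $e_i$, $i\in\mathcal{N}$. For a multiset $Q=\{l_1\le\dots\le l_n\}$ over $\mathcal{N}$ of cardinality $n$, $\widehat{Q}$ denotes the set of all distinct permutations $\underline{j}=j_1\dots j_n$ of $Q$, and $\mathcal{B}_Q$ is the complex vector space with basis the monomials $e_{j_1\dots j_n}:=e_{j_1}\cdots e_{j_n}$, $j_1\dots j_n\in\widehat{Q}$. $\mathcal{B}_Q$ is called generic if $l_1<\dots<l_n$, i.e. $Q$ is a set. Twisted group algebra: $R_n=\mathbb{C}[X_{a\,b}\mid 1\le a,b\le n]$ is the polynomial ring in $n^2$ commuting variables. $\mathcal{A}(S_n)=R_n\rtimes\mathbb{C}[S_n]$ consists of the formal linear combinations $\sum_{g\in S_n}p_g\,g$ with $p_g\in R_n$, with multiplication $(p_1g_1)\cdot(p_2g_2)=(p_1\cdot(g_1.p_2))\,g_1g_2$, where $g.p$ is the polynomial obtained from $p$ by replacing each $X_{a\,b}$ by $X_{g(a)\,g(b)}$, and $g_1g_2$ is the composition ($g_2$ applied first). The representation $\varrho\colon\mathcal{A}(S_n)\to\mathrm{End}(\mathcal{B}_Q)$ (called the twisted regular representation when $Q$ is a set) is given by $\varrho(pg)=\varrho_1(p)\varrho_2(g)$ for $p\in R_n$, $g\in S_n$, extended additively, where $\varrho_1\colon R_n\to\mathrm{End}(\mathcal{B}_Q)$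 is the $\mathbb{C}$-algebra homomorphism with $\varrho_1(X_{a\,b})\,e_{j_1\dots j_n}=q_{j_aj_b}\,e_{j_1\dots j_n}$, and $\varrho_2(g)\,e_{j_1\dots j_n}=e_{j_{g^{-1}(1)}\dots j_{g^{-1}(n)}}$. For $g\in S_n$: $I(g)=\{(a,b)\mid 1\le a<b\le n,\ g(a)>g(b)\}$ and $g^*:=\left(\prod_{(a,b)\in I(g^{-1})}X_{a\,b}\right)g\in\mathcal{A}(S_n)$. For $1\le a\le b\le n$, $t_{b,a}\in S_n$ is the permutation fixing every $p<a$ and every $p>b$, with $t_{b,a}(p)=p+1$ for $a\le p\le b-1$ and $t_{b,a}(b)=a$ (so $t_{a,a}=\mathrm{id}$). $\binom{Q}{m}$ denotes the set of subsets $T\subseteq Q$ with $m$ elements, and $\sigma_T=\prod_{\{i\ne j\}\subset T}\sigma_{ij}$ (product over unordered pairs of distinct elements), where $\sigma_{ij}=q_{ij}q_{ji}$; equivalently $\sigma_T$ is the product of $q_{ij}$ over all ordered pairs of distinct $i,j\in T$. *)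

(* Defs.v *)
From HB Require Import structures.
From mathcomp Require Import all_boot all_order all_algebra all_fingroup.
From mathcomp Require Import zify finmap mpoly.
From mathcomp Require monalg.

Set Implicit Arguments.
Unset Strict Implicit.
Unset Printing Implicit Defensive.

Import GRing.Theory.
Local Open Scope ring_scope.

(* Positions 1, ..., n are represented by the ordinals 0, ..., n-1 throughout.
   The product of 'S_n in MathComp applies its LEFT factor first, so that the
   composition g1 g2 (g2 applied first) is (g2 * g1)%g. *)

Section TwistedGroupAlgebra.
Variables (C : fieldType) (n : nat).

(* C[X_ab | a, b]: the variable X_ab is the one numbered enum_rank (a, b). *)
Local Notation npairs := #|{: 'I_n * 'I_n}|.
Local Notation polyX := {mpoly C[npairs]}.

Definition Xab (a b : 'I_n) : polyX := 'X_(enum_rank (a, b)).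

Definition act_poly (g : 'S_n) (p : polyX) : polyX :=
  p \mPo [tuple Xab (g (enum_val k).1) (g (enum_val k).2) | k < npairs].

HB.instance Definition _ g := GRing.RMorphism.copy (act_poly g)
  (comp_mpoly [tuple Xab (g (enum_val k).1) (g (enum_val k).2) | k < npairs]).

Lemma act_polyX g a b : act_poly g (Xab a b) = Xab (g a) (g b).
Proof. by rewrite /act_poly /Xab comp_mpolyXU -tnth_nth tnth_mktuple enum_rankK. Qed.

Lemma act_polyC g c : act_poly g c%:MP = c%:MP.
Proof. exact: comp_mpolyC. Qed.

Lemma polyX_morph_eq (S : comNzRingType) (f f' : {rmorphism polyX -> S}) :
  (forall c, f c%:MP = f' c%:MP) -> (forall a b, f (Xab a b) = f' (Xab a b)) ->
  f =1 f'.
Proof.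
move=> eqC eqX p; rewrite [p]mpolyE !rmorph_sum; apply: eq_bigr => m _.
rewrite -mul_mpolyC !rmorphM /= eqC; congr (_ * _).
rewrite mpolyXE_id !rmorph_prod; apply: eq_bigr => i _.
rewrite !rmorphXn; congr (_ ^+ _).
by have := eqX (enum_val i).1 (enum_val i).2; rewrite /Xab -surjective_pairing enum_valK.
Qed.

Lemma act_poly1 p : act_poly 1 p = p.
Proof.
apply: (polyX_morph_eq (f := act_poly 1) (f' := idfun)) => [c | a b] /=.
  exact: act_polyC.
by rewrite act_polyX !perm1.
Qed.

Lemma act_polyM g1 g2 p : act_poly (g2 * g1) p = act_poly g1 (act_poly g2 p).
Proof.
apply: (polyX_morph_eq (f := act_poly (g2 * g1))
          (f' := act_poly g1 \o act_poly g2)) => [c | a b] /=.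
  by rewrite !act_polyC.
by rewrite !act_polyX !permM.
Qed.

Definition twalg : Type := {ffun 'S_n -> polyX}.
HB.instance Definition _ := GRing.Zmodule.on twalg.

(* the element p g of the twisted group algebra *)
Definition tw (p : polyX) (g : 'S_n) : twalg := [ffun h => if h == g then p else 0].

Definition twone : twalg := tw 1 1%g.
Definition twmul (x y : twalg) : twalg :=
  \sum_(g1 : 'S_n) \sum_(g2 : 'S_n) tw (x g1 * act_poly g1 (y g2)) (g2 * g1)%g.

Lemma twP (x y : twalg) : (forall g, x g = y g) -> x = y.
Proof. by move=> exy; apply/(@ffunP _ (fun=> polyX) x y). Qed.

Lemma twalg0E g : (0 : twalg) g = 0.
Proof. exact: (ffunE (fun=> 0)). Qed.

Lemma twalgDE (x y : twalg) g : (x + y) g = x g + y g.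
Proof. exact: (ffunE (fun g => x g + y g)). Qed.

Lemma twalg_sumE I (r : seq I) (P : pred I) (F : I -> twalg) g :
  (\sum_(i <- r | P i) F i) g = \sum_(i <- r | P i) F i g.
Proof. exact: (big_morph (fun x : twalg => x g) (fun x y => twalgDE x y g) (twalg0E g)). Qed.

Lemma tw0 g : tw 0 g = 0.
Proof. by apply: twP => h; rewrite twalg0E ffunE if_same. Qed.

Lemma twD g p r : tw (p + r) g = tw p g + tw r g.
Proof. by apply: twP => h; rewrite twalgDE !ffunE; case: ifP => _ //; rewrite addr0. Qed.

Lemma twE (x : twalg) : x = \sum_g tw (x g) g.
Proof.
apply: twP => h; rewrite twalg_sumE (bigD1 h) //= ffunE eqxx big1 ?addr0 // => g.
by rewrite ffunE eq_sym => /negPf->.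
Qed.

Lemma twmulE p1 g1 p2 g2 :
  twmul (tw p1 g1) (tw p2 g2) = tw (p1 * act_poly g1 p2) (g2 * g1)%g.
Proof.
rewrite /twmul (bigD1 g1) //= (bigD1 g2) //= !ffunE !eqxx.
rewrite big1 => [|g /negPf ng]; last by rewrite !ffunE ng rmorph0 mulr0 tw0.
rewrite big1 ?addr0 // => g /negPf ng.
by apply: big1 => g' _; rewrite ffunE ng mul0r tw0.
Qed.

Lemma twmulDl : left_distributive twmul +%R.
Proof.
move=> x y z; rewrite -big_split; apply: eq_bigr => g1 _.
by rewrite -big_split; apply: eq_bigr => g2 _; rewrite /= twalgDE mulrDl twD.
Qed.

Lemma twmulDr : right_distributive twmul +%R.
Proof.
move=> x y z; rewrite -big_split; apply: eq_bigr => g1 _.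
by rewrite -big_split; apply: eq_bigr => g2 _; rewrite /= twalgDE rmorphD mulrDr twD.
Qed.

Lemma twmul0x x : twmul 0 x = 0.
Proof. by apply: (addrI (twmul 0 x)); rewrite -twmulDl !addr0. Qed.

Lemma twmulx0 x : twmul x 0 = 0.
Proof. by apply: (addrI (twmul x 0)); rewrite -twmulDr !addr0. Qed.

Lemma twmul_suml I (r : seq I) (P : pred I) (F : I -> twalg) y :
  twmul (\sum_(i <- r | P i) F i) y = \sum_(i <- r | P i) twmul (F i) y.
Proof. exact: (big_morph (twmul^~ y) (fun u v => twmulDl u v y) (twmul0x y)). Qed.

Lemma twmul_sumr I (r : seq I) (P : pred I) (F : I -> twalg) x :
  twmul x (\sum_(i <- r | P i) F i) = \sum_(i <- r | P i) twmul x (F i).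
Proof. exact: (big_morph (twmul x) (twmulDr x) (twmulx0 x)). Qed.

Lemma twmulA : associative twmul.
Proof.
move=> x y z; rewrite [x]twE (twmul_suml _ _ _ (twmul y z)).
rewrite (twmul_suml _ _ _ y) (twmul_suml _ _ _ z); apply: eq_bigr => g1 _.
set X := tw (x g1) g1; rewrite [y]twE (twmul_suml _ _ _ z) !(twmul_sumr _ _ _ X).
rewrite (twmul_suml _ _ _ z); apply: eq_bigr => g2 _.
set Y := tw (y g2) g2; rewrite [z]twE (twmul_sumr _ _ _ Y) !(twmul_sumr _ _ _ X).
rewrite (twmul_sumr _ _ _ (twmul X Y)); apply: eq_bigr => g3 _; rewrite {}/X {}/Y.
by rewrite !twmulE mulgA rmorphM act_polyM mulrA.
Qed.

Lemma twmul1x : left_id twone twmul.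
Proof.
move=> x; rewrite [x in LHS]twE twmul_sumr [RHS]twE; apply: eq_bigr => g _.
by rewrite twmulE act_poly1 mul1r mulg1.
Qed.

Lemma twmulx1 : right_id twone twmul.
Proof.
move=> x; rewrite [x in LHS]twE twmul_suml [RHS]twE; apply: eq_bigr => g _.
by rewrite twmulE rmorph1 mulr1 mul1g.
Qed.

HB.instance Definition _ := GRing.Zmodule_isPzRing.Build twalg
  twmulA twmul1x twmulx1 twmulDl twmulDr.

(* the set I(g) *)
Definition inversions (g : 'S_n) : {set 'I_n * 'I_n} :=
  [set ab : 'I_n * 'I_n | (ab.1 < ab.2)%N && (g ab.2 < g ab.1)%N].

Definition star (g : 'S_n) : twalg :=
  tw (\prod_(ab in inversions g^-1) Xab ab.1 ab.2) g.

End TwistedGroupAlgebra.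

Section Cycles.
Variable n : nat.

(* The permutation t_{b,a} of the case a <= b, and the identity if b < a. *)
Definition tcyc_fun (b a p : 'I_n) : 'I_n :=
  if (a <= p < b)%N then insubd p p.+1
  else if (a <= b)%N && (p == b) then a else p.

Lemma tcyc_fun_val (b a p : 'I_n) : tcyc_fun b a p =
  (if a <= p < b then p.+1 else if (a <= b) && (p == b) then a else p)%N :> nat.
Proof.
rewrite /tcyc_fun; case: ifP => [/andP[_ pb]|_]; last by case: ifP.
by rewrite val_insubd (leq_ltn_trans pb (ltn_ord b)).
Qed.

Lemma tcyc_inj b a : injective (tcyc_fun b a).
Proof.
move=> p p' /(congr1 val); rewrite /= !tcyc_fun_val => e; apply: val_inj => /=.
move: e; rewrite -!val_eqE /=.
by repeat (case: ifP => ? ); move=> ?; lia.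
Qed.

Definition tcyc (b a : 'I_n) : 'S_n := perm (@tcyc_inj b a).

Lemma tcycE (b a p : 'I_n) : (a <= b)%N ->
  tcyc b a p = (if a <= p < b then p.+1 else if p == b then a else p)%N :> nat.
Proof. by move=> ab; rewrite permE tcyc_fun_val ab. Qed.
End Cycles.

Section WeightSpace.
Variables (C : fieldType) (I : finType).

(* A multiset Q of cardinality n is given by any listing of its elements;
   the words are its distinct rearrangements. *)
Variables (n : nat) (Q : seq I).

Definition word : predArgType := {j : n.-tuple I | perm_eq j Q}.
HB.instance Definition _ := Finite.on word.

Definition letter (j : word) (a : 'I_n) : I := tnth (val j) a.

Lemma letterP (j k : word) : letter j =1 letter k -> j = k.
Proof. by move=> ejk; apply/val_inj/eq_from_tnth. Qed.

(* The vector space with basis the words.  FreeAlgebra.to_free below identifies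
   it with the span of the corresponding monomials in the free algebra. *)
Definition weight_space : Type := {ffun word -> C^o}.
HB.instance Definition _ := Vector.on weight_space.

Definition ebasis (j : word) : weight_space := [ffun k => (k == j)%:R].

Lemma weight_spaceP (v w : weight_space) : (forall j, v j = w j) -> v = w.
Proof. by move=> evw; apply/(@ffunP _ (fun=> C^o) v w). Qed.

Lemma weight_sumE J (r : seq J) (P : pred J) (F : J -> weight_space) j :
  (\sum_(i <- r | P i) F i) j = \sum_(i <- r | P i) F i j.
Proof.
have f0 : (0 : weight_space) j = 0 by exact: (ffunE (fun=> 0)).
have fD (x y : weight_space) : (x + y) j = x j + y j.
  exact: (ffunE (fun j => x j + y j)).
exact: (big_morph (fun x : weight_space => x j) fD f0).
Qed.

Lemma ebasis_sum (v : weight_space) : v = \sum_j v j *: ebasis j.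
Proof.
apply: weight_spaceP => k; rewrite weight_sumE (bigD1 k) //= !ffunE eqxx.
rewrite [_ *: _]mulr1 big1 ?addr0 // => j /negPf njk.
by rewrite !ffunE eq_sym njk [_ *: _]mulr0.
Qed.

(* the endomorphism with prescribed values on the basis *)
Definition on_basis (f : word -> weight_space) : 'End(weight_space) :=
  linfun (fun v : weight_space => \sum_j v j *: f j).

Lemma on_basisE f j : on_basis f (ebasis j) = f j.
Proof.
pose F (v : weight_space) := \sum_j v j *: f j.
have linF : linear F.
  move=> c u v; rewrite /F scaler_sumr -big_split; apply: eq_bigr => k _ /=.
  by rewrite !ffunE scalerDl scalerA.
pose Flin : {linear weight_space -> weight_space} :=
  HB.pack F (GRing.isLinear.Build _ _ _ _ F linF).
rewrite /on_basis (lfunE Flin) /= /F (bigD1 j) //= ffunE eqxx scale1r.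
by rewrite big1 ?addr0 // => k /negPf nkj; rewrite ffunE nkj scale0r.
Qed.

Lemma end_basisP (f f' : 'End(weight_space)) :
  (forall j, f (ebasis j) = f' (ebasis j)) -> f = f'.
Proof.
move=> eff; apply/lfunP => v; rewrite [v]ebasis_sum !linear_sum.
by apply: eq_bigr => j _; rewrite !linearZ /= eff.
Qed.

(* the determinant of f, computed in the basis of words *)
Definition end_det (f : 'End(weight_space)) : C :=
  \det (\matrix_(i, j < #|{: word}|) f (ebasis (enum_val j)) (enum_val i)).

End WeightSpace.

Module FreeAlgebra.
Import monalg.
Section FreeAlgebra.
Variables (C : fieldType) (I : finType).

(* the free unital associative algebra on the generators egen i *)
Definition free_algebra := {malg C[{fmonom I}]}.
Definition egen (i : I) : free_algebra := << fmu i >>.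
Definition emono (s : seq I) : free_algebra := \prod_(i <- s) egen i.

Lemma emonoE s : emono s = << FMonom s >>.
Proof.
elim: s => [|i s IHs]; rewrite /emono ?big_nil ?big_cons -/(emono _).
  by rewrite -fmoneE.
rewrite IHs /egen malgM_def fgmulUU mulr1; congr << _ >>.
by apply: val_inj; rewrite /= fmM fmU.
Qed.

Definition to_free n (Q : seq I) (v : weight_space C n Q) : free_algebra :=
  \sum_j v j *: emono (val j).

Lemma to_free_ebasis n (Q : seq I) (j : word n Q) :
  to_free (ebasis C j) = emono (val j).
Proof.
rewrite /to_free (bigD1 j) //= ffunE eqxx scale1r big1 ?addr0 // => k /negPf nk.
by rewrite ffunE nk scale0r.
Qed.

Lemma to_free_inj n (Q : seq I) : injective (@to_free n Q).
Proof.
move=> v w evw; apply: weight_spaceP => j.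
suff coefE (u : weight_space C n Q) : mcoeff (FMonom (val j)) (to_free u) = u j.
  by rewrite -!coefE evw.
rewrite /to_free raddf_sum (bigD1 j) //= mcoeffZ emonoE mcoeffUU mulr1.
rewrite big1 ?addr0 // => k /negPf nkj.
by rewrite mcoeffZ emonoE mcoeffU1 fmP /= !val_eqE nkj mulr0.
Qed.
End FreeAlgebra.
End FreeAlgebra.

Section Representation.
Variables (C : fieldType) (I : finType) (q : I -> I -> C) (n : nat) (Q : seq I).

Lemma permute_subproof (g : 'S_n) (j : word n Q) :
  perm_eq [tuple letter j (g^-1%g a) | a < n] Q.
Proof.
by apply: perm_trans (valP j); apply/tuple_permP; exists g^-1%g.
Qed.

Definition permute (g : 'S_n) (j : word n Q) : word n Q :=
  Sub [tuple letter j (g^-1%g a) | a < n] (permute_subproof g j).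

Lemma letter_permute g j a : letter (permute g j) a = letter j (g^-1%g a).
Proof. by rewrite /letter /= tnth_mktuple. Qed.

Local Notation npairs := #|{: 'I_n * 'I_n}|.
Local Notation polyX := {mpoly C[npairs]}.
Local Notation BQ := (weight_space C n Q).
Local Notation e := (ebasis C).

(* the values q_{j_a j_b} taken by the variables X_ab at the word j *)
Definition word_eval (j : word n Q) (k : 'I_npairs) : C :=
  q (letter j (enum_val k).1) (letter j (enum_val k).2).

(* The algebra morphism sending X_ab to e_j |-> q_{j_a j_b} e_j is given by
   evaluation, since all these endomorphisms are diagonal in the basis e. *)
Definition rho1 (p : polyX) : 'End(BQ) :=
  on_basis (fun j => p.@[word_eval j] *: e j).

Definition rho2 (g : 'S_n) : 'End(BQ) := on_basis (fun j => e (permute g j)).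

Definition rho (x : twalg C n) : 'End(BQ) := \sum_(g : 'S_n) (rho1 (x g) \o rho2 g)%VF.

Lemma rho1X a b j : rho1 (Xab C a b) (e j) = q (letter j a) (letter j b) *: e j.
Proof. by rewrite on_basisE mevalXU /word_eval enum_rankK. Qed.

Lemma rho1C c : rho1 c%:MP = c *: \1%VF.
Proof. by apply: end_basisP => j; rewrite on_basisE mevalC lfunE /= lfunE. Qed.

Lemma rho1D p r : rho1 (p + r) = rho1 p + rho1 r.
Proof.
by apply: end_basisP => j; rewrite lfunE /= !on_basisE mevalD scalerDl.
Qed.

Lemma rho1M p r : rho1 (p * r) = (rho1 p \o rho1 r)%VF.
Proof.
apply: end_basisP => j.
by rewrite lfunE /= !on_basisE linearZ /= on_basisE mevalM scalerA mulrC.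
Qed.

Lemma rho2E g j : rho2 g (e j) = e (permute g j).
Proof. exact: on_basisE. Qed.

Lemma rho2M g1 g2 : rho2 (g2 * g1) = (rho2 g1 \o rho2 g2)%VF.
Proof.
apply: end_basisP => j; rewrite lfunE /= !rho2E; congr e; apply: letterP => a.
by rewrite !letter_permute invMg permM.
Qed.

Lemma rho2_rho1 g p : (rho2 g \o rho1 p)%VF = (rho1 (act_poly g p) \o rho2 g)%VF.
Proof.
apply: end_basisP => j; rewrite !lfunE /= on_basisE linearZ /= !rho2E on_basisE.
congr (_ *: _).
apply: (polyX_morph_eq (f := meval (word_eval j))
  (f' := meval (word_eval (permute g j)) \o act_poly g)) => [c | a b] /=.
  by rewrite act_polyC !mevalC.
rewrite act_polyX !mevalXU /word_eval !enum_rankK /= !letter_permute.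
by rewrite !permK.
Qed.

Lemma rho_tw p g : rho (tw p g) = (rho1 p \o rho2 g)%VF.
Proof.
have rho10 : rho1 0 = 0 by rewrite -[0]mpolyC0 rho1C scale0r.
rewrite /rho (bigD1 g) //= ffunE eqxx big1 ?addr0 // => h /negPf nhg.
by rewrite ffunE nhg rho10 comp_lfun0l.
Qed.

Lemma rhoD x y : rho (x + y) = rho x + rho y.
Proof.
rewrite /rho -big_split; apply: eq_bigr => g _ /=.
by rewrite twalgDE rho1D comp_lfunDl.
Qed.

Lemma rhoM x y : rho (x * y) = (rho x \o rho y)%VF.
Proof.
have rho0 : rho 0 = 0 by apply: (addrI (rho 0)); rewrite -rhoD !addr0.
pose rho_sum := big_morph rho rhoD rho0.
rewrite -[x * y]/(twmul x y) /twmul rho_sum [rho x in RHS]/rho.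
rewrite (big_morph (fun f => (f \o rho y)%VF) (fun f h => comp_lfunDl f h _) (comp_lfun0l _ _)).
apply: eq_bigr => g1 _; rewrite rho_sum [rho y]/rho.
rewrite (big_morph (fun f => (_ \o f)%VF) (fun f h => comp_lfunDr _ f h) (comp_lfun0r _ _)).
apply: eq_bigr => g2 _; rewrite rho_tw rho1M rho2M.
by rewrite !comp_lfunA; congr (_ \o _)%VF; rewrite -!comp_lfunA rho2_rho1.
Qed.

Lemma rho_1 : rho 1 = \1%VF.
Proof.
rewrite -[1]/(twone C n) rho_tw -[1]mpolyC1 rho1C scale1r comp_lfun1l.
apply: end_basisP => j; rewrite rho2E lfunE /=; congr e; apply: letterP => a.
by rewrite letter_permute invg1 perm1.
Qed.

End Representation.

Definition alpha_star (C : fieldType) (n : nat) : twalg C n := \sum_(g : 'S_n) star C g.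

(* For the 1-based index K = k + 1, this is beta^*_{n-K+1}. *)
Definition beta_star (C : fieldType) (n : nat) (k : 'I_n) : twalg C n :=
  \sum_(m < n | (k <= m)%N) star C (tcyc m k).

Section Sigma.
Variables (C : fieldType) (N : {fset nat}) (q : N -> N -> C).

Definition sigma2 (i j : N) : C := q i j * q j i.

(* Unordered pairs of distinct elements are enumerated with i < j. *)
Definition sigma (T : {set N}) : C :=
  \prod_(i in T) \prod_(j in T | (val i < val j)%N) sigma2 i j.
End Sigma.

(* Main.v *)
Require Import Defs.
From mathcomp Require Import all_boot all_order all_algebra all_fingroup.
From mathcomp Require Import cyclic separable cyclotomic zify mpoly.
From mathcomp Require Import finmap complex reals.

Set Implicit Arguments.
Unset Strict Implicit.
Unset Printing Implicit Defensive.

Import GRing.Theory.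
Local Open Scope ring_scope.

(** A word on n distinct letters is recorded by the permutation sending each
    letter to its position; in this basis [star g] is a weighted permutation
    matrix, whose entry at (r * g, r) is the product of q x y over the pairs of
    letters with x before y in r * g and y before x in r ([inv_weight]).

    Part (ii).  Write t_m for the operator of the rotation of the window of
    positions k, ..., m, and b_m = t_k + ... + t_(m-1), so that B is the last
    of the b_m.  Comparing the two ways of bringing first the m-th and then an
    earlier letter to the front gives ([beta_mx_zagier])
        b_(m+1) (1 - t_m) = (1 - t') b_m,
    where t' rotates the window k+1, ..., m and multiplies by sigma_xy for the
    letters x, y at the positions k and m.  Hence det b_(m+1) follows from
    det b_m and from two determinants 1 - (weighted window rotation).

    If P is a weighted rotation of a window of length l and z a primitive
    l-th root of unity, then P and zP are conjugate by a diagonal matrix of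
    powers of z; since 1 - P^l is the product of the 1 - z^i P,
        det (1 - P)^l = det (1 - P^l),
    and P^l is diagonal ([det_1B_tcyc]).  With r = m - k + 1, its entries are
    the sigma_T for both t_m and t', where T is the set of the r letters in
    positions k, ..., m, and each T occurs for r! (n-r)! words
    ([card_perm_preimset]).  So
        det (1 - t_m)^r = det (1 - t')^(r-1) = prod_T (1 - sigma_T)^(r! (n-r)!),
    and the relation above, raised to the power r (r-1), becomes
        (det b_(m+1))^(r(r-1))
          = (prod_T (1 - sigma_T)^((r-2)! (n-r)!) * det b_m)^(r(r-1)).
    Both the cancellation of powers of 1 - sigma_T and the extraction of this
    root are done after replacing every q_xy by X q_xy in C[X]: all the
    factors then have constant term 1 ([det_beta_mx_step]), and X = 1 gives
    the recursion back.

    Part (i).  Placing the letters one position after the other factors the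
    sum of all [star g] as a product of the operators of part (ii)
    ([alpha_mx_rec]). *)

(** * Weighted permutation matrices *)

Section WeightedPermutations.
Variables (A : comNzRingType) (n : nat).
Implicit Types (g h p r : 'S_n) (w v : 'S_n -> A).

(** The basis vector of r goes to w r times the one of r * g: when r sends
    letters to positions, moving the letter in position a to position g a
    multiplies r by g on this side. *)
Definition wperm g w : 'M[A]_#|{: 'S_n}| :=
  \matrix_(i, j) ((enum_val i == enum_val j * g)%g%:R * w (enum_val j)).

Lemma eq_wperm g w v : w =1 v -> wperm g w = wperm g v.
Proof. by move=> ewv; apply/matrixP => i j; rewrite !mxE ewv. Qed.

Lemma wpermM g h w v :
  wperm g w *m wperm h v = wperm (h * g)%g (fun r => w (r * h)%g * v r).
Proof.
apply/matrixP => i j; rewrite !mxE.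
rewrite (bigD1 (enum_rank (enum_val j * h)%g)) //= !mxE enum_rankK eqxx mul1r.
rewrite mulgA mulrA big1 ?addr0 // => k nk; rewrite !mxE.
suff /negPf-> : enum_val k != (enum_val j * h)%g by rewrite mul0r mulr0.
by apply: contraNneq nk => <-; rewrite enum_valK.
Qed.

Lemma wperm_diag w : wperm 1 w = diag_mx (\row_i w (enum_val i)).
Proof.
apply/matrixP => i j; rewrite !mxE mulg1 (inj_eq enum_val_inj).
by case: eqP => [->|_]; rewrite ?mul1r ?mul0r ?mulr1n ?mulr0n.
Qed.

Lemma wperm1 : wperm 1 (fun=> 1) = 1%:M.
Proof.
rewrite wperm_diag -diag_const_mx; congr diag_mx.
by apply/rowP => i; rewrite !mxE.
Qed.

Lemma scale_wperm a g w : a *: wperm g w = wperm g (fun r => a * w r).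
Proof. by apply/matrixP => i j; rewrite !mxE mulrCA. Qed.

Lemma exp_wperm g w l :
  (wperm g w) ^+ l = wperm (g ^+ l)%g (fun r => \prod_(i < l) w (r * g ^+ i)%g).
Proof.
elim: l => [|l IHl].
  rewrite expr0 expg0 -[1]wperm1; apply: eq_wperm => r.
  by rewrite big_ord0.
rewrite exprS IHl -[_ * _]/(_ *m _) wpermM -expgSr; apply: eq_wperm => r.
by rewrite big_ord_recr /= mulrC.
Qed.

Lemma det_diagB w : \det (1%:M - wperm 1 w) = \prod_p (1 - w p).
Proof.
rewrite -[1%:M]diag_const_mx wperm_diag -raddfB /= det_diag.
rewrite (reindex (@enum_val _ {: 'S_n})) /=; last first.
  by apply: onW_bij; apply: enum_val_bij.
by apply: eq_bigr => i _; rewrite !mxE.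
Qed.

End WeightedPermutations.

(** * Roots of unity and determinants *)

Section RootsOfUnity.

Lemma prim_root_exists (C : numClosedFieldType) l :
  (0 < l)%N -> exists z : C, l.-primitive_root z.
Proof.
move=> l_gt0; pose p : {poly C} := 'X^l - 1.
have [r Dp] := closed_field_poly_normal p.
rewrite (monicP _) ?monicXnsubC // scale1r in Dp.
have rl1: all l.-unity_root r.
  by apply/allP=> z; rewrite -root_prod_XsubC -Dp.
have sz_r: (l < (size r).+1)%N.
  by rewrite -(size_prod_XsubC r id) -Dp size_XnsubC.
have [|z] := hasP (has_prim_root l_gt0 rl1 _ sz_r); last by exists z.
rewrite -separable_prod_XsubC -Dp separable_Xn_sub_1 //.
by rewrite Num.Theory.pnatr_eq0 -lt0n.
Qed.

(** The factorization of 'X^l - 1 read backwards: the roots are the powers of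
    the inverse of z, and c collects the leading coefficients. *)
Lemma prod_1_sub_rootX (F : fieldType) l (z : F) : l.-primitive_root z ->
  \prod_(i < l) (1 - z ^+ i *: 'X) = 1 - 'X^l :> {poly F}.
Proof.
move=> pz; have l_gt0 := prim_order_gt0 pz.
have z0 : z != 0.
  apply/eqP => z0; have /eqP := prim_expr_order pz.
  by rewrite z0 expr0n gtn_eqF // eq_sym oner_eq0.
have pzV : l.-primitive_root z^-1.
  rewrite /primitive_root_of_unity l_gt0 /=; apply/forallP => i.
  by have /andP[_ /forallP/(_ i)] := pz; rewrite !unity_rootE exprVn invr_eq1.
have e i : 1 - z ^+ i *: 'X = (- z ^+ i) *: ('X - (z^-1 ^+ i)%:P).
  rewrite scalerBr scaleNr -[X in _ = _ - X]mul_polyC -polyCM exprVn mulNr.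
  by rewrite mulfV ?expf_neq0 // polyCN opprK addrC.
pose c := \prod_(i < l) - z ^+ i.
have prodE : \prod_(i < l) (1 - z ^+ i *: 'X) = c *: ('X^l - 1).
  rewrite (eq_bigr _ (fun (i : 'I_l) _ => e i)) scaler_prod.
  by rewrite -(factor_Xn_sub_1 pzV) big_mkord.
suff c1 : c = -1 by rewrite prodE c1 scaleN1r opprB.
(* Both sides of prodE are known at 0, which determines c. *)
have /(congr1 (horner^~ 0)) := prodE.
rewrite horner_prod !hornerE big1 => [|i _].
  by rewrite expr0n gtn_eqF // sub0r mulrN1 => ->; rewrite opprK.
by rewrite !hornerE ?mulr0 ?subr0.
Qed.

End RootsOfUnity.

Section RootPower.
Variables (A : idomainType) (N : nat).
Implicit Types (P D : 'M[A]_N).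

(** D conjugates P to z *: P, hence all the factors of
    1 - P^l = prod_i (1 - z^i P) have the same determinant. *)
Lemma det_1B_exp P D (z : A) l :
    \det D != 0 -> D *m P = z *: (P *m D) ->
    \prod_(i < l) (1 - z ^+ i *: 'X) = 1 - 'X^l :> {poly A} ->
  \det (1%:M - P) ^+ l = \det (1%:M - P ^+ l).
Proof.
move=> D0 DP.
have e i : \det (1%:M - z ^+ i *: P) = \det (1%:M - P).
  elim: i => [|i <-]; first by rewrite expr0 scale1r.
  apply: (mulIf D0); rewrite [RHS]mulrC -!det_mulmx; congr (\det _).
  rewrite mulmxBl mulmxBr mul1mx mulmx1 -scalemxAl -scalemxAr DP scalerA.
  by rewrite -exprSr.
move=> facX.
transitivity (\prod_(i < l) \det (1%:M - z ^+ i *: P)).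
  by rewrite (eq_bigr _ (fun (i : 'I_l) _ => e i)) prodr_const card_ord.
case: N P {D D0 DP e} => [|N'] P.
  by rewrite det_mx00 big1 // => i _; rewrite det_mx00.
have /(congr1 (horner_mx P)) := facX.
rewrite rmorphB rmorph1 rmorphXn /= horner_mx_X rmorph_prod => <-.
rewrite (big_morph _ (@det_mulmx _ _) (@det1 _ _)); apply: eq_bigr => i _.
rewrite rmorphB /= horner_mxZ horner_mx_X.
by rewrite -[1 in X in _ = \det (X - _)]/(1%:P) horner_mx_C.
Qed.

End RootPower.

(** * Rotations of a window of positions *)

Section WindowRotation.
Variables (n : nat) (b a : 'I_n).
Hypothesis leab : (a <= b)%N.
Local Notation t := (tcyc b a).
Local Notation l := (b - a).+1.

(** The graph of the rotation as a linear arithmetic disjunction, in the form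
    that [lia] can split. *)
Lemma tcyc_cases (c : 'I_n) :
     (a <= c < b)%N /\ t c = c.+1 :> nat
  \/ c = b :> nat /\ t c = a :> nat
  \/ ~~ (a <= c <= b)%N /\ t c = c :> nat.
Proof. by rewrite tcycE // -(inj_eq val_inj) /=; do 2?[case: ifP]; lia. Qed.

Lemma tcyc_last : t b = a.
Proof. by apply: val_inj; rewrite /= tcycE // ltnn andbF eqxx. Qed.

Lemma tcyc_window c : (a <= t c <= b)%N = (a <= c <= b)%N.
Proof. by rewrite tcycE // -(inj_eq val_inj) /=; do 2?[case: ifP]; lia. Qed.

Lemma tcyc_expE i (c : 'I_n) :
  (a <= c)%N -> (c + i <= b)%N -> (t ^+ i)%g c = (c + i)%N :> nat.
Proof.
move=> ac; elim: i => [|i IHi] cib; first by rewrite expg0 perm1 addn0.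
rewrite expgSr permM tcycE // IHi; last by lia.
by case: ifP; lia.
Qed.

Lemma tcyc_out i (c : 'I_n) : ~~ (a <= c <= b)%N -> (t ^+ i)%g c = c.
Proof.
move=> ac; elim: i => [|i IHi]; first by rewrite expg0 perm1.
rewrite expgSr permM IHi; apply: val_inj.
by have := tcyc_cases c => /=; lia.
Qed.

Lemma tcyc_order : (t ^+ l)%g = 1%g.
Proof.
apply/permP => c; rewrite perm1.
have [/andP[ac cb]|/tcyc_out->//] := boolP (a <= c <= b)%N.
(* c reaches b, then a, and climbs back to c. *)
have -> : l = (b - c + 1 + (c - a))%N by lia.
rewrite expgD permM addn1 expgSr permM.
have -> : (t ^+ (b - c))%g c = b by apply: val_inj; rewrite /= tcyc_expE; lia.
by rewrite tcyc_last; apply: val_inj; rewrite /= tcyc_expE; lia.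
Qed.

Lemma tcyc_expV_last i : (i < l)%N -> ((t ^+ i)^-1)%g b = (b - i)%N :> nat.
Proof.
move=> il; have bin : (b - i < n)%N by have := ltn_ord b; lia.
suff -> : ((t ^+ i)^-1)%g b = Ordinal bin by [].
by apply: (canLR (permK _)); apply: val_inj; rewrite /= tcyc_expE /=; lia.
Qed.

(** Along one full turn every position of the window is exactly once the one
    from which the last position gets its letter. *)
Lemma big_tcyc_last V (idx : V) (op : Monoid.com_law idx) (F : 'I_n -> V) :
  \big[op/idx]_(i < l) F ((t ^+ i)^-1%g b)
    = \big[op/idx]_(c < n | (a <= c <= b)%N) F c.
Proof.
rewrite [RHS](reindex_onto (fun i : 'I_l => (t ^+ i)^-1%g b)
                (fun c : 'I_n => inord (b - c))) /=.
  apply: eq_bigl => i; rewrite tcyc_expV_last ?ltn_ord //.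
  apply/esym/andP; split; first by have := ltn_ord i; lia.
  by apply/eqP/val_inj; rewrite /= inordK; have := ltn_ord i; lia.
by move=> c /andP[ac cb]; apply: val_inj; rewrite /= inordK ?tcyc_expV_last; lia.
Qed.

Lemma card_window : #|[set c : 'I_n | (a <= c <= b)%N]| = l.
Proof.
rewrite -sum1_card; under eq_bigl do rewrite inE.
by rewrite -(big_tcyc_last _ (fun=> 1%N)) sum_nat_const card_ord muln1.
Qed.

(** P rotates the window and multiplies by a weight of the letter y that goes
    from the last to the first place, a weight om p y which is otherwise
    invariant under the rotation; one full turn therefore multiplies by the
    weights of all letters of the window.  The conjugation of P to z *: P is
    by the powers of z given by the position of a letter x p of the window:
    [pick] chooses it from the set of these letters, so that the choice is not
    affected by the rotation, while its position moves by one modulo l. *)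
Lemma det_1B_tcyc (A : idomainType) (z : A) (om : 'S_n -> 'I_n -> A) :
    l.-primitive_root z ->
    \prod_(i < l) (1 - z ^+ i *: 'X) = 1 - 'X^l :> {poly A} ->
    (forall p, om (p * t)%g =1 om p) ->
  \det (1%:M - wperm t (fun p => om p (p^-1%g b))) ^+ l =
  \prod_(p : 'S_n) (1 - \prod_(y < n | (a <= p y <= b)%N) om p y).
Proof.
move=> pz facX omt.
pose x (p : 'S_n) := odflt a [pick y : 'I_n | (a <= p y <= b)%N].
pose d (p : 'S_n) := z ^+ p (x p).
have xP (p : 'S_n) : (a <= p (x p) <= b)%N.
  rewrite /x; case: pickP => [y //|/(_ (p^-1%g a))].
  by rewrite permKV leqnn leab.
have xt (p : 'S_n) : x (p * t)%g = x p.
  by congr (odflt _ _); apply: eq_pick => y; rewrite permM tcyc_window.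
have dt (p : 'S_n) : d (p * t)%g = z * d p.
  rewrite /d xt permM tcycE // -(inj_eq val_inj) /= -exprS.
  have := xP p; case: ifP => [//|wx]; case: ifP => [/eqP->|]; last by lia.
  move=> _; have -> : b.+1 = (l + a)%N by lia.
  by rewrite exprD (prim_expr_order pz) mul1r.
have omti i (p : 'S_n) : om (p * t ^+ i)%g =1 om p.
  elim: i => [|i IHi] y; first by rewrite expg0 mulg1.
  by rewrite expgSr mulgA omt.
rewrite (@det_1B_exp _ _ _ (wperm 1 d) z) //.
- rewrite exp_wperm tcyc_order det_diagB; apply: eq_bigr => p _; congr (1 - _).
  rewrite [RHS](reindex_inj (@perm_inj _ p^-1%g)) /=.
  under [RHS]eq_bigl do rewrite permKV.
  rewrite -(big_tcyc_last _ (fun c => om p (p^-1%g c))); apply: eq_bigr => i _.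
  by rewrite omti invMg permM.
- rewrite wperm_diag det_diag; apply/prodf_neq0 => i _; rewrite mxE expf_neq0 //.
  apply/eqP => z0; have := prim_expr_order pz.
  by rewrite z0 expr0n => /esym/eqP; rewrite oner_eq0.
rewrite !wpermM scale_wperm mul1g mulg1; apply: eq_wperm => p.
by rewrite mulg1 dt mulrAC mulrA.
Qed.

End WindowRotation.

(** * The operators of g* and a braid relation *)

Section Inversions.
Variables (A : comNzRingType) (n : nat) (q : 'I_n -> 'I_n -> A).
Implicit Types (p r g : 'S_n) (x y k m j : 'I_n).

Definition inv_weight p r : A :=
  \prod_x \prod_(y | (p x < p y)%N && (r y < r x)%N) q x y.

Definition star_mx g := wperm g (fun r => inv_weight (r * g) r).

Definition win_weight (a b : nat) r y : A :=
  \prod_(x | (a <= r x <= b)%N && (x != y)) q y x.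

(** The rotation inverts exactly the pairs formed by the letter leaving
    position m and another letter of the window. *)
Lemma inv_weight_tcyc k m r : (k <= m)%N ->
  inv_weight (r * tcyc m k)%g r = win_weight k m r (r^-1%g m).
Proof.
move=> km; rewrite /inv_weight (bigD1 (r^-1%g m)) //= [X in _ * X]big1 ?mulr1.
  apply: eq_bigl => y; rewrite !permM permKV tcyc_last // tcycE //.
  rewrite -(inj_eq (@perm_inj _ r)) permKV -!(inj_eq val_inj) /=.
  by do 2?[case: ifP]; lia.
move=> x; rewrite -(inj_eq (@perm_inj _ r)) permKV -(inj_eq val_inj) /= => xm.
apply: big1 => y; rewrite !permM !tcycE // -!(inj_eq val_inj) /=.
by do 4?[case: ifP]; lia.
Qed.

Lemma star_mx1 : star_mx 1 = 1%:M.
Proof.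
rewrite -wperm1; apply: eq_wperm => r; rewrite mulg1.
by apply: big1 => x _; apply: big1 => y; lia.
Qed.

Lemma tcyc_id k : tcyc k k = 1%g.
Proof.
apply/permP => p; apply: val_inj; rewrite perm1.
by have := tcyc_cases (leqnn k) p => /=; lia.
Qed.

Lemma tcyc_braid k k1 j j1 m :
    k1 = k.+1 :> nat -> j1 = j.+1 :> nat -> (k <= j < m)%N ->
  (tcyc m k * tcyc j1 k = tcyc j k * tcyc m k1)%g.
Proof.
move=> ek ej kjm; apply/permP => p; apply: val_inj; rewrite !permM /=.
have km : (k <= m)%N by lia.
have kj1 : (k <= j1)%N by lia.
have kj : (k <= j)%N by lia.
have k1m : (k1 <= m)%N by lia.
have := tcyc_cases km p; have := tcyc_cases kj1 (tcyc m k p).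
by have := tcyc_cases kj p; have := tcyc_cases k1m (tcyc j k p); lia.
Qed.

(** For k1 = k + 1 this is the operator of (t_(k+1,k)^* )^2 t_(m,k+1)^*: the
    rotation brings the letter y of position m next to the letter x of
    position k, and exchanging these two letters twice multiplies by
    sigma_xy. *)
Definition swap_star_mx k k1 m := wperm (tcyc m k1) (fun r =>
  q (r^-1%g k) (r^-1%g m) * q (r^-1%g m) (r^-1%g k)
    * win_weight k1 m r (r^-1%g m)).

(** Let x and y be the letters in positions j and m.  On the left y is brought
    to position k and then x in front of it; on the right x is brought to
    position k and then y next to it.  The weights agree up to the pair
    {x, y}, inverted twice on the left and not at all by the two rotations on
    the right: hence the factor sigma_xy of [swap_star_mx]. *)
Lemma star_mx_braid k k1 j j1 m :
    k1 = k.+1 :> nat -> j1 = j.+1 :> nat -> (k <= j < m)%N ->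
  star_mx (tcyc j1 k) *m star_mx (tcyc m k) =
  swap_star_mx k k1 m *m star_mx (tcyc j k).
Proof.
move=> ek ej kjm; have /andP[kj jm] := kjm.
rewrite !wpermM (tcyc_braid ek ej kjm); apply: eq_wperm => r.
rewrite !inv_weight_tcyc; try lia.
set r1 := (r * tcyc m k)%g; set r2 := (r * tcyc j k)%g.
have r1V : r1^-1%g j1 = r^-1%g j.
  apply: (canLR (permK _)); rewrite permM permKV; apply: val_inj.
  by rewrite /= tcycE -?(inj_eq val_inj) /=; try lia; do 2?[case: ifP]; lia.
have r2Vk : r2^-1%g k = r^-1%g j.
  by apply: (canLR (permK _)); rewrite permM permKV tcyc_last.
have r2Vm : r2^-1%g m = r^-1%g m.
  apply: (canLR (permK _)); rewrite permM permKV; apply: val_inj.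
  by rewrite /= tcycE -?(inj_eq val_inj) /=; try lia; do 2?[case: ifP]; lia.
rewrite r1V r2Vk r2Vm.
have yE x i : (x == r^-1%g i) = (r x == i :> nat).
  by rewrite (inj_eq val_inj) -(inj_eq (@perm_inj _ r)) permKV.
have -> : win_weight k j1 r1 (r^-1%g j) =
          q (r^-1%g j) (r^-1%g m) * win_weight k j r (r^-1%g j).
  rewrite /win_weight (bigD1 (r^-1%g m)) /=; last first.
    by rewrite !yE permM permKV tcyc_last; lia.
  congr (_ * _); apply: eq_bigl => x; rewrite !yE permM tcycE; last by lia.
  by rewrite -(inj_eq val_inj) /=; do 2?[case: ifP]; lia.
have -> : win_weight k m r (r^-1%g m) =
          q (r^-1%g m) (r^-1%g j) * win_weight k1 m r2 (r^-1%g m).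
  rewrite /win_weight (bigD1 (r^-1%g j)) /=; last by rewrite !yE permKV; lia.
  congr (_ * _); apply: eq_bigl => x; rewrite !yE permM tcycE //.
  by rewrite -(inj_eq val_inj) /=; do 2?[case: ifP]; lia.
by rewrite mulrACA [X in _ * X]mulrC mulrA.
Qed.

(** With m = n this is the operator of beta^*; the partial sums carry the
    recursion. *)
Definition beta_mx k (m : nat) :=
  \sum_(j < n | (k <= j < m)%N) star_mx (tcyc j k).

Lemma beta_mx_recr k m : (k <= m)%N ->
  beta_mx k m.+1 = beta_mx k m + star_mx (tcyc m k).
Proof.
move=> km; rewrite /beta_mx (bigD1 m) /=; last by lia.
rewrite addrC; congr (_ + _); apply: eq_bigl => j.
by rewrite -(inj_eq val_inj) /=; lia.
Qed.

Lemma beta_mx_recl k k1 m : k1 = k.+1 :> nat -> (k < m)%N ->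
  beta_mx k m.+1 *m star_mx (tcyc m k) =
    star_mx (tcyc m k) + swap_star_mx k k1 m *m beta_mx k m.
Proof.
move=> ek km; rewrite /beta_mx (bigD1 k) /=; last by lia.
rewrite tcyc_id star_mx1 mulmxDl mul1mx; congr (_ + _).
rewrite mulmx_suml mulmx_sumr.
(* The remaining indices k < j <= m are shifted down by one. *)
rewrite (reindex_onto (fun j : 'I_n => insubd j j.+1)
                      (fun j : 'I_n => insubd j j.-1)) /=.
  apply: eq_big => [j | j].
    rewrite -!(inj_eq val_inj) /= !val_insubd.
    by have := ltn_ord j; have := ltn_ord m; do 2?[case: ifP]; lia.
  rewrite -!(inj_eq val_inj) /= !val_insubd => kjm.
  have := ltn_ord m; have := ltn_ord j => jn mn.
  apply: star_mx_braid => //; last by move: kjm; do 4?[case: ifP]; lia.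
  by rewrite val_insubd; move: kjm; do 4?[case: ifP]; lia.
move=> j; rewrite -!(inj_eq val_inj) /= => kjm; apply: val_inj.
by have := ltn_ord j; rewrite /= !val_insubd; do 2?[case: ifP]; lia.
Qed.

(** The last rotation cancels against the product of the first one, the
    identity, with it; the other products are matched by [star_mx_braid]. *)
Lemma beta_mx_zagier k k1 m : k1 = k.+1 :> nat -> (k < m)%N ->
  beta_mx k m.+1 *m (1%:M - star_mx (tcyc m k)) =
  (1%:M - swap_star_mx k k1 m) *m beta_mx k m.
Proof.
move=> ek km; rewrite mulmxBr mulmx1 (beta_mx_recl ek km).
rewrite beta_mx_recr ?(ltnW km) //.
by rewrite mulmxBl mul1mx opprD addrA addrK.
Qed.

End Inversions.

(** * Permutations with a given preimage of a set *)

Section CountPreimages.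
Variable I : finType.
Implicit Types (T U : {set I}) (p g : {perm I}).

Lemma perm_preimset_exists T U : #|T| = #|U| -> exists g, g @^-1: U = T.
Proof.
move=> eTU.
have eC : #|~: T| = #|~: U| by have := cardsC T; have := cardsC U; lia.
pose s (V : {set I}) := enum V ++ enum (~: V).
have s_uniq V : uniq (s V).
  rewrite cat_uniq !enum_uniq andbT /=; apply/hasPn => x.
  by rewrite !mem_enum inE.
have s_mem V x : x \in s V by rewrite mem_cat !mem_enum inE orbN.
have s_size V : size (s V) = #|I| by rewrite size_cat -!cardE cardsC.
have [x0|I0] := pickP I; last first.
  exists 1%g; apply/setP => x; by have := I0 x.
pose f x := nth x0 (s U) (index x (s T)).
have f_inj : injective f.
  have ilt x : (index x (s T) < size (s U))%N.
    by rewrite s_size -(s_size T) index_mem.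
  move=> x y /eqP; rewrite nth_uniq //.
  by move/eqP/(congr1 (nth x0 (s T))); rewrite !nth_index.
exists (perm f_inj); apply/setP => x; rewrite inE permE /f /s.
rewrite index_cat mem_enum nth_cat; case: (boolP (x \in T)) => xT.
  have ix : (index x (enum T) < size (enum U))%N.
    by rewrite -cardE -eTU cardE index_mem mem_enum.
  by rewrite ix -(mem_enum U) mem_nth.
rewrite -!cardE -eTU ltnNge leq_addr /= addKn.
apply/negbTE; rewrite -in_setC -(mem_enum (~: U)) mem_nth //.
by rewrite -cardE -eC cardE index_mem mem_enum inE.
Qed.

(** The count does not depend on the set T of the given size, because left
    multiplication by a permutation carries one case to another; and these
    counts add up to the number of all permutations. *)
Lemma card_perm_preimset T U : #|T| = #|U| ->
  #|[set p : {perm I} | p @^-1: U == T]| = ((#|U|)`! * (#|I| - #|U|)`!)%N.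
Proof.
pose c (V : {set I}) := #|[set p : {perm I} | p @^-1: U == V]|; rewrite -/(c T).
have c_eq (V : {set I}) : #|V| = #|U| -> c V = c U.
  move=> eVU; have [g gV] := perm_preimset_exists eVU.
  rewrite /c -(card_preimset _ (mulgI g)); apply: eq_card => p; rewrite !inE.
  rewrite -{1}gV; apply/eqP/eqP => [e|{2}<-]; last first.
    by apply/setP => x; rewrite !inE permM.
  by apply/setP => x; have /setP/(_ (g^-1%g x)) := e; rewrite !inE permM permKV.
move=> eTU; rewrite (c_eq T eTU).
have : (\sum_(V : {set I} | #|V| == #|U|) c V = (#|I|)`!)%N.
  have cardI : #|{: {perm I}}| = (#|I|)`!.
    rewrite -cardsT -(card_perm [set: I]); apply: eq_card => p.
    by apply/esym/subsetP => x _; rewrite inE.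
  rewrite -{}cardI -[RHS]sum1_card.
  rewrite [RHS](partition_big (fun p : {perm I} => p @^-1: U)
                  (fun V => #|V| == #|U|)) /=.
    apply: eq_bigr => V _; rewrite sum1_card /c.
    by apply: eq_card => p; rewrite !inE.
  by move=> p _; rewrite card_preimset //; apply: perm_inj.
rewrite (eq_bigr (fun=> c U)) => [|V /eqP/c_eq //].
rewrite sum_nat_const -cardsE card_draws -(bin_fact (max_card (mem U))) => /eqP.
by rewrite eqn_pmul2l ?bin_gt0 ?max_card // => /eqP.
Qed.

Lemma prod_perm_preimset (A : comNzRingType) (F : {set I} -> A) U :
  \prod_(p : {perm I}) F (p @^-1: U) =
  \prod_(T : {set I} | #|T| == #|U|) F T ^+ ((#|U|)`! * (#|I| - #|U|)`!)%N.
Proof.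
rewrite (partition_big (fun p : {perm I} => p @^-1: U)
           (fun T => #|T| == #|U|)) /=.
  apply: eq_bigr => T /eqP eTU.
  rewrite (eq_bigr (fun=> F T)) => [|p /eqP-> //].
  rewrite prodr_const -(card_perm_preimset eTU); congr (_ ^+ _).
  by apply: eq_card => p; rewrite !inE.
by move=> p _; rewrite card_preimset //; apply: perm_inj.
Qed.

End CountPreimages.

(** * Determinants of weighted window rotations *)

Section SigmaSet.
Variables (A : comNzRingType) (I : finType) (q : I -> I -> A).

(** The form of sigma_T over ordered pairs, for any finite set of indices. *)
Definition sigma_set (T : {set I}) : A :=
  \prod_(x in T) \prod_(y in T | y != x) q x y.

Lemma sigma_setU1 z (T : {set I}) : z \notin T ->
  sigma_set (z |: T) =
    \prod_(x in T) (q z x * q x z * \prod_(y in T | y != x) q x y).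
Proof.
move=> zT; rewrite /sigma_set big_setU1 //= !big_split /= -mulrA; congr (_ * _).
  apply: eq_bigl => y; rewrite !inE; case: eqP => [->|_] /=.
    by rewrite (negPf zT).
  by rewrite andbT.
rewrite -big_split; apply: eq_bigr => x xT; have xz : z != x.
  by apply: contraNneq zT => ->.
rewrite (bigD1 z) /=; last by rewrite !inE eqxx xz.
congr (_ * _); apply: eq_bigl => y; rewrite !inE; case: eqP => [->|_] /=.
  by rewrite (negPf zT) andbF.
by rewrite andbT.
Qed.
End SigmaSet.

Section WindowDeterminants.
Variables (A : idomainType) (n : nat) (q : 'I_n -> 'I_n -> A).

(** Stated for an integral domain so that it applies to polynomials, where
    the roots of unity are constants. *)
Hypothesis roots : forall l, (0 < l)%N -> exists2 z : A, l.-primitive_root z &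
  \prod_(i < l) (1 - z ^+ i *: 'X) = 1 - 'X^l :> {poly A}.
Implicit Types (p : 'S_n) (k m : 'I_n).

Lemma win_weight_rot (a b : 'I_n) p : (a <= b)%N ->
  win_weight q a b (p * tcyc b a)%g =1 win_weight q a b p.
Proof.
move=> ab y; apply: eq_bigl => x; rewrite permM.
by have := tcyc_cases ab (p x); lia.
Qed.

Lemma det_1B_star_mx k m : (k <= m)%N ->
  \det (1%:M - star_mx q (tcyc m k)) ^+ (m - k).+1 =
  \prod_(T : {set 'I_n} | #|T| == (m - k).+1)
     (1 - sigma_set q T) ^+ ((m - k).+1`! * (n - (m - k).+1)`!)%N.
Proof.
move=> km; have [z pz facz] := roots (ltn0Sn (m - k)).
have -> : star_mx q (tcyc m k) =
          wperm (tcyc m k) (fun r => win_weight q k m r (r^-1%g m)).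
  by apply: eq_wperm => r; rewrite inv_weight_tcyc.
rewrite (det_1B_tcyc km pz facz); last first.
  by move=> p; apply: win_weight_rot.
rewrite -(card_window km) -[X in (X - _)%N](card_ord n) -prod_perm_preimset.
apply: eq_bigr => p _; congr (1 - _); rewrite /sigma_set.
apply: eq_big => [y | y _].
  by rewrite !inE.
by apply: eq_bigl => x; rewrite !inE.
Qed.

(** The letter x in position k stays there during the rotation of the other
    letters of the window, so the product over one turn is sigma of these,
    times sigma_xy for each of them: again sigma of the whole window. *)
Lemma det_1B_swap_star_mx k k1 m : k1 = k.+1 :> nat -> (k < m)%N ->
  \det (1%:M - swap_star_mx q k k1 m) ^+ (m - k) =
  \prod_(T : {set 'I_n} | #|T| == (m - k).+1)
     (1 - sigma_set q T) ^+ ((m - k).+1`! * (n - (m - k).+1)`!)%N.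
Proof.
move=> ek km; have k1m : (k1 <= m)%N by rewrite ek.
have el : (m - k = (m - k1).+1)%N by lia.
have [z pz facz] := roots (ltn0Sn (m - k1)).
pose om (r : 'S_n) y := q (r^-1%g k) y * q y (r^-1%g k) * win_weight q k1 m r y.
rewrite {1}el (det_1B_tcyc (om := om) k1m pz facz); last first.
  move=> p y; rewrite /om win_weight_rot //.
  suff -> : ((p * tcyc m k1)^-1)%g k = p^-1%g k by [].
  apply: (canLR (permK _)); rewrite permM permKV; apply: val_inj => /=.
  by have := tcyc_cases k1m k; lia.
rewrite -(card_window (ltnW km)) -[X in (X - _)%N](card_ord n).
rewrite -prod_perm_preimset.
apply: eq_bigr => p _; congr (1 - _).
have -> : p @^-1: [set c : 'I_n | (k <= c <= m)%N] =
    p^-1%g k |: [set y | (k1 <= p y <= m)%N].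
  apply/setP => y; rewrite !inE -(inj_eq (@perm_inj _ p)) permKV.
  by rewrite -(inj_eq val_inj) /=; lia.
rewrite sigma_setU1; last by rewrite inE permKV ek ltnn.
apply: eq_big => [y | y _]; first by rewrite inE.
by congr (_ * _); apply: eq_bigl => x; rewrite !inE.
Qed.

End WindowDeterminants.

Section Morphism.
Variables (A B : comNzRingType) (f : {rmorphism A -> B}) (n : nat).
Variable q : 'I_n -> 'I_n -> A.
Local Notation qf := (fun x y => f (q x y)).

Lemma rmorph_sigma_set (T : {set 'I_n}) : f (sigma_set q T) = sigma_set qf T.
Proof.
by rewrite rmorph_prod; apply: eq_bigr => x _; rewrite rmorph_prod.
Qed.

Lemma map_star_mx g : map_mx f (star_mx q g) = star_mx qf g.
Proof.
apply/matrixP => i j; rewrite !mxE rmorphM rmorph_nat rmorph_prod.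
by congr (_ * _); apply: eq_bigr => x _; rewrite rmorph_prod.
Qed.

Lemma map_beta_mx k m : map_mx f (beta_mx q k m) = beta_mx qf k m.
Proof. by rewrite map_mx_sum; apply: eq_bigr => j _; apply: map_star_mx. Qed.
End Morphism.

(** * The determinant of beta^* *)

Section Polynomials.
Variable C : numClosedFieldType.

Lemma poly_roots l : (0 < l)%N -> exists2 z : {poly C}, l.-primitive_root z &
  \prod_(i < l) (1 - z ^+ i *: 'X) = 1 - 'X^l :> {poly {poly C}}.
Proof.
move=> l0; have [z pz] := prim_root_exists C l0; exists z%:P.
  by rewrite fmorph_primitive_root.
have /(congr1 (map_poly polyC)) := prod_1_sub_rootX pz.
rewrite rmorph_prod rmorphB rmorph1 /= map_polyXn => <-.
apply: eq_bigr => i _.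
by rewrite rmorphB rmorph1 /= map_polyZ map_polyX rmorphXn.
Qed.

(** The cofactor of f - g in f^e - g^e has the constant term e, which is not
    zero. *)
Lemma expr_const1_inj (e : nat) (f g : {poly C}) : (0 < e)%N ->
  f.[0] = 1 -> g.[0] = 1 -> f ^+ e = g ^+ e -> f = g.
Proof.
move=> e0 f0 g0 /eqP; rewrite -subr_eq0 subrXX mulf_eq0 subr_eq0.
case/orP=> /eqP // /(congr1 (horner^~ 0)).
rewrite horner_sum (eq_bigr (fun=> 1)) => [|i _].
  rewrite sumr_const card_ord horner0 => /eqP.
  by rewrite Num.Theory.pnatr_eq0 eqn0Ngt e0.
by rewrite hornerM !horner_exp f0 g0 !expr1n mulr1.
Qed.

End Polynomials.

Section DetBeta.
Variables (C : numClosedFieldType) (n : nat).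
Implicit Types (q : 'I_n -> 'I_n -> C) (k m : 'I_n).

Lemma beta_mx_id (A : comNzRingType) (q : 'I_n -> 'I_n -> A) k :
  beta_mx q k k.+1 = 1%:M.
Proof.
rewrite /beta_mx (big_pred1 k) ?tcyc_id ?star_mx1 // => j /=.
by rewrite -(inj_eq val_inj) /=; lia.
Qed.

Lemma beta_mx_0 (A : comNzRingType) k (m : nat) : (k < m)%N ->
  beta_mx (fun _ _ : 'I_n => 0 : A) k m = 1%:M.
Proof.
move=> km; rewrite /beta_mx (bigD1 k) /=; last by lia.
rewrite tcyc_id star_mx1 big1 ?addr0 // => j.
rewrite -(inj_eq val_inj) /= => kj.
apply/matrixP => u v; rewrite !mxE inv_weight_tcyc; last by lia.
rewrite /win_weight (bigD1 ((enum_val v)^-1%g k)) /= ?mul0r ?mulr0 // permKV.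
by rewrite (inj_eq (@perm_inj _ _)) -(inj_eq val_inj) /=; lia.
Qed.

Lemma sigma_set_0 (A : comNzRingType) (I : finType) (T : {set I}) :
  (1 < #|T|)%N -> sigma_set (fun _ _ => 0 : A) T = 0.
Proof.
case/card_gt1P=> x [y [xT yT xy]].
by rewrite /sigma_set (bigD1 x) //= (bigD1 y) /= ?yT 1?eq_sym // !mul0r.
Qed.

(** The relation [beta_mx_zagier] is read over C[X] with X q_xy for q_xy, and
    G e is the product of the (1 - sigma_T)^e there.  With d = m - k, the
    power d + 1 of det (1 - t_m) and the power d of det (1 - t') are both G c;
    so in the relation raised to the power (d + 1) d, they become (G c)^d and
    (G c)^(d+1), leaving one factor G c = (G c')^((d+1) d) on the right.  At
    X = 0 only the identity survives in b_m and every sigma_T vanishes: the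
    constant terms are 1, which permits the cancellation and the root. *)
Lemma det_beta_mx_step q k m : (k < m)%N ->
  \det (beta_mx q k m.+1) =
  (\prod_(T : {set 'I_n} | #|T| == (m - k).+1)
     (1 - sigma_set q T) ^+ ((m - k).-1`! * (n - (m - k).+1)`!)%N)
  * \det (beta_mx q k m).
Proof.
move=> km; pose Q x y : {poly C} := 'X * (q x y)%:P.
have kn : (k.+1 < n)%N by have := ltn_ord m; lia.
pose k1 := Ordinal kn.
set d := (m - k)%N; have d0 : (0 < d)%N by rewrite subn_gt0.
set c' := (d.-1`! * _)%N; pose c := (d.+1`! * (n - d.+1)`!)%N.
pose G e := \prod_(T : {set 'I_n} | #|T| == d.+1) (1 - sigma_set Q T) ^+ e.
have G_exp e i : G e ^+ i = G (e * i)%N.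
  by rewrite -prodrXl; apply: eq_bigr => T _; rewrite -exprM.
have eval0 (T : {set 'I_n}) : #|T| = d.+1 -> (sigma_set Q T).[0] = 0.
  move=> cT; have -> : (sigma_set Q T).[0] = horner_eval 0 (sigma_set Q T) by [].
  rewrite rmorph_sigma_set -[RHS](@sigma_set_0 C _ T) ?cT //.
  apply: eq_bigr => x _; apply: eq_bigr => y _.
  by rewrite /= /horner_eval /Q !hornerE.
have sg_neq0 (T : {set 'I_n}) : #|T| = d.+1 -> 1 - sigma_set Q T != 0.
  move=> cT; apply/eqP => /(congr1 (horner^~ 0)).
  rewrite hornerD hornerN eval0 // hornerC subr0 horner0 => /eqP.
  by rewrite oner_eq0.
have det0 (j : nat) : (k < j)%N -> (\det (beta_mx Q k j)).[0] = 1.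
  move=> kj; rewrite -[LHS]/(horner_eval 0 _) -det_map_mx map_beta_mx.
  rewrite -[RHS](det1 _ #|{: 'S_n}|) -(beta_mx_0 _ kj); congr (\det _).
  apply: eq_bigr => i _; apply/matrixP => u v; rewrite !mxE; congr (_ * _).
  apply: eq_bigr => x _; apply: eq_bigr => y _.
  by rewrite /= /horner_eval /Q !hornerE.
have cE : c = (c' * (d.+1 * d))%N.
  by rewrite /c /c' -{1}(prednK d0) !factS prednK //; lia.
suff /(congr1 (horner^~ 1)) :
    \det (beta_mx Q k m.+1) = G c' * \det (beta_mx Q k m).
  rewrite -[(\det _).[1]]/(horner_eval 1 _) -det_map_mx map_beta_mx hornerM.
  rewrite -[(\det _).[1]]/(horner_eval 1 _) -det_map_mx map_beta_mx.
  have Q1 x y : horner_eval 1 (Q x y) = q x y.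
    by rewrite /= /horner_eval /Q !hornerE.
  have b1 (j : nat) :
      beta_mx (fun x y => horner_eval 1 (Q x y)) k j = beta_mx q k j.
    apply: eq_bigr => i _; apply/matrixP => u v; rewrite !mxE; congr (_ * _).
    by apply: eq_bigr => x _; apply: eq_bigr => y _.
  rewrite !b1 => ->; congr (_ * _).
  rewrite -[LHS]/(horner_eval 1 _) rmorph_prod; apply: eq_bigr => T _.
  rewrite rmorphXn rmorphB rmorph1 /= rmorph_sigma_set; congr ((1 - _) ^+ _).
  by apply: eq_bigr => x _; apply: eq_bigr => y _; exact: Q1.
have zag := beta_mx_zagier Q (erefl _ : k1 = k.+1 :> nat) km.
have /(congr1 (fun x => x ^+ (d.+1 * d))) := congr1 (fun M => \det M) zag.
rewrite !det_mulmx !exprMn.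
rewrite (_ : \det (1%:M - swap_star_mx _ _ _ _) ^+ _ = G c ^+ d.+1); last first.
  by rewrite mulnC exprM det_1B_swap_star_mx //; apply: poly_roots.
rewrite [\det (1%:M - star_mx _ _) ^+ _]exprM det_1B_star_mx ?(ltnW km) //;
  last exact: poly_roots.
rewrite -/d -/(G c) => e1.
have Gd_neq0 : G c ^+ d != 0.
  rewrite expf_neq0 //; apply/prodf_neq0 => T /eqP cT.
  by rewrite expf_neq0 ?sg_neq0.
apply: (@expr_const1_inj _ (d.+1 * d)).
- by rewrite muln_gt0.
- by rewrite det0 // ltnS ltnW.
- rewrite hornerM det0 // mulr1 horner_prod big1 // => T /eqP cT.
  by rewrite horner_exp hornerD hornerN eval0 // hornerC subr0 expr1n.
by apply: (mulIf Gd_neq0); rewrite e1 exprMn (G_exp c') -cE exprS mulrAC.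
Qed.

Lemma det_beta_mx q k (m : nat) : (k < m <= n)%N ->
  \det (beta_mx q k m) = \prod_(2 <= r < (m - k).+1)
    \prod_(T : {set 'I_n} | #|T| == r)
      (1 - sigma_set q T) ^+ ((r - 2)`! * (n - r)`!)%N.
Proof.
elim: m => // m IHm kmn; have [mk|mk] := eqVneq m (k : nat).
  by rewrite mk beta_mx_id det1 subSnn big_geq.
have mn : (m < n)%N by lia.
rewrite (det_beta_mx_step q (m := Ordinal mn)) /=; last by lia.
rewrite IHm; last by lia.
rewrite subSn; last by lia.
rewrite [RHS]big_nat_recr; last by lia.
by rewrite mulrC subSS subn1.
Qed.

End DetBeta.

(** * The determinant of alpha^* *)

Section AlphaFactorization.
Variables (A : comNzRingType) (n : nat) (q : 'I_n -> 'I_n -> A).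
Implicit Types (p r s g h : 'S_n) (k m x y : 'I_n).

(** If no pair inverted from s to r is inverted back from r to p, the
    inversions from s to p split into those of the two steps. *)
Lemma inv_weight_mul p r s :
    (forall x y, (p x < p y)%N -> (r y < r x)%N -> (s y < s x)%N) ->
  inv_weight q p r * inv_weight q r s = inv_weight q p s.
Proof.
move=> prs; rewrite /inv_weight -big_split; apply: eq_bigr => x _ /=.
rewrite [RHS](bigID (fun y => (r y < r x)%N)) /=.
congr (_ * _); apply: eq_bigl => y.
  by have := prs x y; lia.
have [->|nxy] := eqVneq y x; first by rewrite !ltnn.
have neq (g : 'S_n) : g y != g x :> nat.
  by rewrite (inj_eq val_inj) (inj_eq (@perm_inj _ g)).
by have := prs y x; have := neq p; have := neq r; lia.
Qed.

Definition fixes_below (k : nat) g :=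
  [forall i : 'I_n, (i < k)%N ==> (g i == i)].

(** The rotation inverts only pairs involving the letter that it brings to
    position k, and h keeps that letter in front of the later ones. *)
Lemma star_mxM k m h : (k <= m)%N -> fixes_below k.+1 h ->
  star_mx q h *m star_mx q (tcyc m k) = star_mx q (tcyc m k * h)%g.
Proof.
move=> km /forallP fh; rewrite wpermM; apply: eq_wperm => r.
rewrite mulgA; apply: inv_weight_mul => x y; rewrite !permM.
have tx := tcyc_cases km (r x); have ty := tcyc_cases km (r y).
move: tx ty; set u := tcyc m k (r x); set v := tcyc m k (r y) => tx ty huv vu.
have hfix (w : 'I_n) : (w <= k)%N -> h w = w.
  by move=> wk; apply/eqP/(implyP (fh w)).
have kv : (k < v)%N.
  rewrite ltnNge; apply/negP => vk; have hv := hfix v vk.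
  have huk : (h u <= k)%N by rewrite hv in huv; lia.
  have /perm_inj hu := hfix _ huk.
  by rewrite hv hu in huv; lia.
by lia.
Qed.

Definition alpha_mx (k : nat) := \sum_(g : 'S_n | fixes_below k g) star_mx q g.

Lemma fixes_below_tcyc k m h : (k <= m)%N ->
  fixes_below k (tcyc m k * h)%g && ((tcyc m k * h)^-1%g k == m) =
  fixes_below k.+1 h.
Proof.
move=> km.
have tfix (i : 'I_n) : (i < k)%N -> tcyc m k i = i.
  by move=> ik; apply: val_inj; have := tcyc_cases km i => /=; lia.
have -> : ((tcyc m k * h)^-1%g k == m) = (h k == k).
  by rewrite -(inj_eq (@perm_inj _ (tcyc m k * h)%g)) permKV permM tcyc_last.
apply/andP/forallP => [[/forallP fh /eqP hk] i | fh].
  rewrite ltnS leq_eqVlt; apply/implyP => /orP[/eqP/val_inj->|ik].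
    by rewrite hk.
  by have := implyP (fh i) ik; rewrite permM tfix.
split; last by apply: implyP (fh k) _.
apply/forallP => i; apply/implyP => ik; rewrite permM tfix //.
by apply: implyP (fh i) _; apply: ltnW.
Qed.

(** A permutation of the positions from k on first brings to position k the
    letter that ends there, and then permutes the later positions. *)
Lemma alpha_mx_rec k : alpha_mx k = alpha_mx k.+1 *m beta_mx q k n.
Proof.
rewrite /beta_mx mulmx_sumr /alpha_mx.
rewrite (partition_big (fun g => g^-1%g k) (fun m : 'I_n => (k <= m < n)%N)) /=.
  apply: eq_bigr => m /andP[km _]; rewrite mulmx_suml.
  rewrite (reindex_inj (mulgI (tcyc m k))) /=.
  apply: eq_big => [h | h]; last first.
    rewrite fixes_below_tcyc // => fh; exact/esym/star_mxM.
  by rewrite fixes_below_tcyc.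
move=> g /forallP fg; rewrite ltn_ord andbT leqNgt; apply/negP => gk.
have /eqP := implyP (fg _) gk; rewrite permKV => /(congr1 val)/=; lia.
Qed.

End AlphaFactorization.

Lemma det_alpha_mx0 (A : comNzRingType) (n : nat) (q : 'I_n -> 'I_n -> A) :
  \det (alpha_mx q 0) = \prod_(k < n) \det (beta_mx q k n).
Proof.
have alpha_mx_n : alpha_mx q n = 1%:M.
  rewrite -(star_mx1 q) /alpha_mx (big_pred1 1%g) // => g /=.
  apply/forallP/eqP => [fg | -> i]; last by rewrite perm1 eqxx implybT.
  by apply/permP => i; rewrite perm1; apply/eqP/(implyP (fg i)).
suff step j : (j <= n)%N ->
    \det (alpha_mx q 0) =
    \det (alpha_mx q j) * \prod_(k < n | (k < j)%N) \det (beta_mx q k n).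
  rewrite (step n) // alpha_mx_n det1 mul1r.
  by apply: eq_bigl => k; rewrite ltn_ord.
elim: j => [_|j IHj jn].
  by rewrite big_pred0 ?mulr1 // => k; rewrite ltn0.
rewrite IHj ?(ltnW jn) // (alpha_mx_rec q (Ordinal jn)) det_mulmx -mulrA.
congr (_ * _); rewrite [RHS](bigD1 (Ordinal jn)) //=; congr (_ * _).
by apply: eq_bigl => k; rewrite -(inj_eq val_inj) /=; lia.
Qed.

Lemma det_alpha_mx (C : numClosedFieldType) (n : nat) (q : 'I_n -> 'I_n -> C) :
  \det (alpha_mx q 0) = \prod_(2 <= r < n.+1)
    \prod_(T : {set 'I_n} | #|T| == r)
      (1 - sigma_set q T) ^+ ((r - 2)`! * (n - r + 1)`!)%N.
Proof.
rewrite det_alpha_mx0.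
pose F r := \prod_(T : {set 'I_n} | #|T| == r)
  (1 - sigma_set q T) ^+ ((r - 2)`! * (n - r)`!)%N.
transitivity (\prod_(k < n) \prod_(2 <= r < n.+1 | (r < (n - k).+1)%N) F r).
  apply: eq_bigr => k _; rewrite det_beta_mx ?ltn_ord ?leqnn //.
  by rewrite (big_nat_widen _ _ n.+1) // ltnS leq_subr.
rewrite (exchange_big_dep xpredT) //=.
rewrite big_nat_cond [RHS]big_nat_cond.
apply: eq_bigr => r /andP[/andP[r2 rn] _].
(* The factor of index r occurs for the n - r + 1 values k <= n - r. *)
transitivity (\prod_(k < n | (k < n - r + 1)%N) F r).
  by apply: eq_bigl => k; have := ltn_ord k; lia.
rewrite -(big_ord_widen n (fun=> F r)); last by lia.
rewrite prodr_const card_ord -prodrXl; apply: eq_bigr => T _.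
by rewrite -exprM -mulnA; congr (_ ^+ (_ * _)%N); rewrite addn1 factS mulnC.
Qed.

(** * From words to permutations *)

Lemma det_mxsub_bij (A : comNzRingType) (m n : nat) (f : 'I_m -> 'I_n)
    (M : 'M[A]_n) :
  bijective f -> \det (mxsub f f M) = \det M.
Proof.
move=> bf; have emn : m = n.
  by rewrite -(card_ord m) -(card_ord n); apply: bij_eq_card bf.
case: n / emn f M bf => f M bf.
have -> : mxsub f f M =
          row_perm (perm (bij_inj bf)) (col_perm (perm (bij_inj bf)) M).
  by apply/matrixP => i j; rewrite !mxE !permE.
rewrite row_permE col_permE !det_mulmx !det_perm odd_permV.
by rewrite mulrCA -signr_addb addbb mulr1.
Qed.

Section Sigma.
Variables (C : fieldType) (N : {fset nat}) (q : N -> N -> C).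

Lemma sigmaE T : sigma q T = sigma_set q T.
Proof.
rewrite /sigma_set; transitivity (
    \prod_(i in T) \prod_(j in T | (val i < val j)%N) q i j
  * \prod_(i in T) \prod_(j in T | (val j < val i)%N) q i j).
  rewrite [X in _ * X](exchange_big_dep (mem T)) /=; last by move=> i j _ /andP[].
  rewrite -big_split; apply: eq_bigr => i iT /=.
  by rewrite iT -big_split.
rewrite -big_split; apply: eq_bigr => i iT /=.
rewrite [RHS](bigID (fun j => (val i < val j)%N)) /=.
congr (_ * _); apply: eq_bigl => j.
  by rewrite -(inj_eq val_inj) /=; case: (j \in T) => //=; lia.
by rewrite -(inj_eq val_inj) /=; case: (j \in T) => //=; lia.
Qed.
End Sigma.

Section SubsetsOfImage.
Variables (A : comNzRingType) (I J : finType) (f : I -> J).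
Hypothesis f_inj : injective f.

Lemma sigma_set_imset (q : J -> J -> A) (T : {set I}) :
  sigma_set q (f @: T) = sigma_set (fun x y => q (f x) (f y)) T.
Proof.
rewrite /sigma_set big_imset /=; last exact: in2W f_inj.
apply: eq_bigr => x xT.
rewrite big_mkcondr big_imset /=; last exact: in2W f_inj.
by rewrite -big_mkcondr; apply: eq_bigl => y; rewrite (inj_eq f_inj).
Qed.

Lemma prod_subsets_imset (F : {set J} -> A) m :
  \prod_(T : {set I} | #|T| == m) F (f @: T) =
  \prod_(T : {set J} | (T \subset f @: [set: I]) && (#|T| == m)) F T.
Proof.
rewrite [RHS](reindex_onto (fun T : {set I} => f @: T) (fun T => f @^-1: T)) /=.
  apply: eq_bigl => T; rewrite imsetS ?subsetT // card_imset //=.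
  have -> : f @^-1: (f @: T) = T by apply/setP => x; rewrite inE mem_imset.
  by rewrite eqxx andbT.
move=> T /andP[/subsetP sT _]; apply/setP => y; apply/imsetP/idP => [[x]|yT].
  by rewrite inE => ? ->.
by have /imsetP[x _ ey] := sT _ yT; exists x => //; rewrite inE -ey.
Qed.
End SubsetsOfImage.

Section Bridge.
Variables (C : fieldType) (I : finType) (q : I -> I -> C) (n : nat).
Variable Q : n.-tuple I.
Hypothesis uniqQ : uniq Q.
Local Notation qQ := (fun x y : 'I_n => q (tnth Q x) (tnth Q y)).
Implicit Types (p r g : 'S_n).

Lemma tnth_uniq_inj : injective (tnth Q).
Proof. exact/tuple_uniqP. Qed.

Lemma word_of_perm_subproof p : perm_eq [tuple tnth Q (p^-1%g a) | a < n] Q.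
Proof. by apply/tuple_permP; exists p^-1%g. Qed.

(** p sends letters to positions, so position a carries the letter p^-1 a. *)
Definition word_of_perm p : word n Q :=
  Sub [tuple tnth Q (p^-1%g a) | a < n] (word_of_perm_subproof p).

Lemma letter_word_of_perm p a : letter (word_of_perm p) a = tnth Q (p^-1%g a).
Proof. by rewrite /letter /= tnth_mktuple. Qed.

Lemma word_of_perm_inj : injective word_of_perm.
Proof.
move=> p r epr; apply: invg_inj; apply/permP => a; apply: tnth_uniq_inj.
by rewrite -!letter_word_of_perm epr.
Qed.

Lemma word_of_perm_bij : bijective word_of_perm.
Proof.
apply: inj_card_bij; first exact: word_of_perm_inj.
rewrite -(card_codom word_of_perm_inj); apply/subset_leq_card/subsetP => j _.
have /tuple_permP[s es] := valP j; apply/codomP; exists s^-1%g.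
apply: letterP => a; rewrite letter_word_of_perm invgK /letter.
rewrite (_ : val j = [tuple tnth Q (s i) | i < n]) ?tnth_mktuple //.
exact: val_inj.
Qed.

Lemma permute_word_of_perm g r :
  permute g (word_of_perm r) = word_of_perm (r * g)%g.
Proof.
apply: letterP => a; rewrite letter_permute !letter_word_of_perm.
by rewrite invMg permM.
Qed.

(** A pair (a, b) of positions in I(g^-1) is the pair of places, in the
    permuted word, of two letters whose order g reverses. *)
Lemma rho_star_coef g p r :
  rho q Q (star C g) (ebasis C (word_of_perm r)) (word_of_perm p) =
    (p == r * g)%g%:R * inv_weight qQ (r * g)%g r.
Proof.
rewrite rho_tw lfunE /= rho2E on_basisE permute_word_of_perm !ffunE.
rewrite (inj_eq word_of_perm_inj) mulrC; congr (_ * _).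
rewrite rmorph_prod /inv_weight pair_big_dep /=.
pose e (ab : 'I_n * 'I_n) := ((r * g)%g ab.1, (r * g)%g ab.2).
rewrite (reindex_inj (h := e)) /=; last first.
  by move=> [a b] [a' b'] [/perm_inj-> /perm_inj->].
apply: eq_big => [[a b] | [a b] _] /=.
  by rewrite inE /= !permM !permK.
by rewrite mevalXU /word_eval enum_rankK /= !letter_word_of_perm !permK.
Qed.

Lemma end_det_sum_star J (s : seq J) (P : pred J) (F : J -> 'S_n) :
  end_det (rho q Q (\sum_(j <- s | P j) star C (F j))) =
  \det (\sum_(j <- s | P j) star_mx qQ (F j)).
Proof.
pose f (i : 'I_#|{: 'S_n}|) := enum_rank (word_of_perm (enum_val i)).
have bf : bijective f.
  apply: (bij_comp (f := @enum_rank _)); first exact: enum_rank_bij.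
  by apply: bij_comp; [exact: word_of_perm_bij | exact: enum_val_bij].
rewrite /end_det -(det_mxsub_bij _ bf); congr (\det _).
apply/matrixP => i j; rewrite !mxE !enum_rankK summxE.
have rho0 : rho q Q (0 : twalg C n) = 0.
  by apply: (addrI (rho q Q 0)); rewrite -rhoD !addr0.
rewrite (big_morph _ (@rhoD _ _ _ _ _) rho0) sum_lfunE weight_sumE.
by apply: eq_bigr => k _; rewrite rho_star_coef !mxE.
Qed.

End Bridge.

(* For Q a set with n elements, rho q n (enum Q) is the twisted regular
   representation on B_Q; in (ii), the ordinal k stands for the index k + 1. *)
Theorem theorem4p12 (R : realType) (N : {fset nat}) (q : N -> N -> complex R)
    (n : nat) (Q : {set N}) (hn : (2 <= n)%N) (hQ : #|Q| = n) :
  (end_det (rho q (enum Q) (alpha_star (complex R) n)) =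
     \prod_(2 <= m < n.+1) \prod_(T : {set N} | (T \subset Q) && (#|T| == m))
       (1 - sigma q T) ^+ ((m - 2)`! * (n - m + 1)`!)%N)
  /\
  (forall k : 'I_n, (k.+1 <= n - 1)%N ->
   end_det (rho q (enum Q) (beta_star (complex R) k)) =
     \prod_(2 <= m < (n - k.+1 + 1).+1)
       \prod_(T : {set N} | (T \subset Q) && (#|T| == m))
         (1 - sigma q T) ^+ ((m - 2)`! * (n - m)`!)%N).
Proof.
have szQ : size (enum Q) == n by rewrite -cardE hQ.
pose Qt := Tuple szQ; have uQ : uniq Qt by apply: enum_uniq.
pose lam := tnth Qt; have lam_inj : injective lam by apply: tnth_uniq_inj.
have QE : Q = lam @: [set: 'I_n].
  apply/setP => x; rewrite -mem_enum.
  by apply/(tnthP Qt)/imsetP => [[i ->]|[i _ ->]]; exists i.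
have prodE e m : \prod_(T : {set N} | (T \subset Q) && (#|T| == m))
    (1 - sigma q T) ^+ e = \prod_(T : {set 'I_n} | #|T| == m)
    (1 - sigma_set (fun x y => q (lam x) (lam y)) T) ^+ e.
  rewrite QE -(prod_subsets_imset lam_inj (fun T => (1 - sigma q T) ^+ e)).
  by apply: eq_bigr => T _; rewrite sigmaE sigma_set_imset.
split=> [|k kn].
  rewrite -[enum Q]/(val Qt) (end_det_sum_star q uQ).
  under [RHS]eq_bigr do rewrite prodE.
  rewrite -det_alpha_mx; congr (\det _); apply: eq_bigl => g.
  by apply/esym/forallP => i; rewrite ltn0.
rewrite -[enum Q]/(val Qt) (end_det_sum_star q uQ).
under [RHS]eq_bigr do rewrite prodE.
have -> : (n - k.+1 + 1 = n - k)%N by lia.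
rewrite -det_beta_mx; last by rewrite ltn_ord leqnn.
by congr (\det _); apply: eq_bigl => j; rewrite ltn_ord andbT.
Qed.
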